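(* Let $k\ge 1$ and $n\ge 1$ be integers, let $R=\{c_1,\dots,c_k\}$ be a set of $k$ colors, and let $\Gamma_{k,R}$ be an acyclic $k$-colored digraph with vertex set $[n]=\{1,\dots,n\}$, labeled so that $i<j$ whenever there is an edge from $i$ to $j$. Let $\{x_i^{(t)} : i\in[n],\ t\in[k]\}$ be commuting indeterminates. Define the $n\times n$ matrix $A_{\Gamma_{k,R}}=(a_{ij})$ by $$a_{ij}=\begin{cases} 1+\sum_{t\in[k]} x_i^{(t)}, & i=j,\\[2pt] \sum_{t\in [k]\setminus S_{ij}} x_i^{(t)}, & i<j,\\[2pt] \sum_{t\in[k]} x_i^{(t)}, & i>j,\end{cases}$$ where for $i<j$, $S_{ij}\subseteq[k]$ is the set of indices $t$ such that there is an edge from $i$ to $j$ colored $c_t$ (so $a_{ij}=\sum_{t\in[k]}x_i^{(t)}$ if there is no edge from $i$ to $j$, and $a_{ij}=0$ if there are edges from $i$ to $j$ of all $k$ colors). Then $$\det(A_{\Gamma_{k,R}})=1+\sum_{P}\ \sum_{a=1}^{k} x_{i_1}^{(r_1)}x_{i_2}^{(r_2)}\cdots x_{i_{t-1}}^{(r_{t-1})}\,x_{i_t}^{(a)},$$ where $P$ ranges over all colored paths $i_1\xrightarrow{c_{r_1}} i_2\xrightarrow{c_{r_2}}\cdots\xrightarrow{c_{r_{t-1}}} i_t$ in $\Gamma_{k,R}$ (with $t\ge 1$; a path consisting of a single vertex $i_1$ contributes $\sum_{a=1}^k x_{i_1}^{(a)}$).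
   Context: A $k$-colored digraph $\Gamma_{k,R}$ is a digraph equipped with a finite color set $R=\{c_1,\dots,c_k\}$ such that for each ordered pair of vertices $(i,j)$ there are $\ell$ directed edges from $i$ to $j$ for some $0\le \ell\le k$, these edges receiving pairwise distinct colors from $R$. It is acyclic if it has no directed cycle. A colored path $i_1\xrightarrow{c_{r_1}} i_2\xrightarrow{c_{r_2}}\cdots\xrightarrow{c_{r_{t-1}}} i_t$ is a directed path through the vertices $i_1,\dots,i_t$ in which, for each $s=1,\dots,t-1$, a specific edge from $i_s$ to $i_{s+1}$ of color $c_{r_s}$ is chosen (colors need not be distinct along the path); paths using different colored edges between the same vertices are counted as different paths. The variable $x_i^{(t)}$ is associated with vertex $i$ and color $c_t$. *)

(* Defs.v *)
From HB Require Import structures.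
From mathcomp Require Import all_boot all_order all_algebra.
From mathcomp Require Import mpoly.

Set Implicit Arguments.
Unset Strict Implicit.
Unset Printing Implicit Defensive.

Import GRing.Theory.
Local Open Scope ring_scope.

(* [G i j] is the set of colors of the edges from [i] to [j]. *)
Definition colored_digraph (V C : finType) := V -> V -> {set C}.

Section ColoredDigraph.
Variables (V C : finType) (G : colored_digraph V C).

Definition has_edge : rel V := fun i j => G i j != set0.

(* A cycle is a nonempty closed walk, so a loop counts as a cycle. *)
Definition acyclic := forall c : seq V, cycle has_edge c -> c = [::].

(* The pair (i_1, [:: (r_1, i_2); ...; (r_(t-1), i_t)]) encodes the sequence
   i_1 -r_1-> i_2 -r_2-> ... -r_(t-1)-> i_t. *)
Fixpoint colored_walk (i : V) (s : seq (C * V)) : bool :=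
  if s is (r, j) :: s' then (r \in G i j) && colored_walk j s' else true.

Definition is_colored_path (p : V * seq (C * V)) : bool :=
  colored_walk p.1 p.2 && uniq (p.1 :: unzip2 p.2).

Record colored_path := ColoredPath {
  path_val :> V * seq (C * V);
  path_valP : is_colored_path path_val
}.

HB.instance Definition _ := [isSub for path_val].
HB.instance Definition _ := [Countable of colored_path by <:].

(* The vertices of a path are distinct, hence there are finitely many paths. *)
Definition enum_colored_path : seq colored_path :=
  pmap insub
    [seq (u.1, bseqval u.2) | u <- enum {: V * {bseq #|V| of C * V}}].

Lemma enum_colored_pathP : Finite.axiom enum_colored_path.
Proof.
apply: Finite.uniq_enumP.
  apply: pmap_sub_uniq; rewrite map_inj_uniq ?enum_uniq //.
  by move=> [i s] [j u] [-> /val_inj ->].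
move=> p; rewrite mem_pmap_sub; apply/mapP.
have szp : (size (path_val p).2 <= #|V|)%N.
  case: p => [[i s]] /= /andP[_ /card_uniqP /= e].
  by have := max_card (mem (i :: unzip2 s)); rewrite e size_map => /ltnW.
by exists ((path_val p).1, Bseq szp); rewrite ?mem_enum //=; case: (path_val p).
Qed.

HB.instance Definition _ := isFinite.Build colored_path enum_colored_pathP.

Lemma colored_walk_path i s : colored_walk i s -> path has_edge i (unzip2 s).
Proof.
elim: s i => //= -[r j] s IHs i /= /andP[rij /IHs ->].
by rewrite andbT; apply/set0Pn; exists r.
Qed.

(* In an acyclic digraph the distinctness condition is automatic. *)
Lemma acyclic_is_colored_path p :
  acyclic -> is_colored_path p = colored_walk p.1 p.2.
Proof.
case: p => i s acG; rewrite /is_colored_path /=.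
have [/colored_walk_path|] //= := boolP (colored_walk i s).
elim: (unzip2 s) i => {s} //= j s IHs i /andP[eij ps].
have /= -> := IHs j ps; rewrite andbT; apply/negP => iin.
have : path has_edge i (j :: s) by rewrite /= eij.
case/splitPr: iin => p1 p2; rewrite cat_path /= => /and3P[p1P lp1 _].
have := acG (i :: p1); rewrite /= rcons_path p1P lp1 => /(_ isT); discriminate.
Qed.

End ColoredDigraph.

Section Determinant.
Variables (R : comNzRingType) (n k : nat).

(* [indet R i t] is the indeterminate x_i^(t). *)
Definition indet (i : 'I_n) (t : 'I_k) : {mpoly R[n * k]} :=
  'X_(mxvec_index i t).

Variable G : colored_digraph 'I_n 'I_k.

Definition digraph_mx : 'M[{mpoly R[n * k]}]_n :=
  \matrix_(i, j)
    if i == j then 1 + \sum_(t < k) indet i t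
    else if (i < j)%N then \sum_(t < k | t \notin G i j) indet i t
    else \sum_(t < k) indet i t.

(* [path_monomial i s a] is x_(i_1)^(r_1) ... x_(i_(t-1))^(r_(t-1)) x_(i_t)^(a)
   for the path encoded by [(i, s)]. *)
Fixpoint path_monomial (i : 'I_n) (s : seq ('I_k * 'I_n)) (a : 'I_k)
    : {mpoly R[n * k]} :=
  if s is (r, j) :: s' then indet i r * path_monomial j s' a else indet i a.

End Determinant.

Arguments indet R {n k} i t.
Arguments digraph_mx R {n k} G.
Arguments path_monomial R {n k} i s a.

(* Main.v *)
Require Import Defs.
From mathcomp Require Import all_boot all_order all_algebra.
From mathcomp Require Import mpoly.

Import GRing.Theory.
Local Open Scope ring_scope.

(** With [u_i = \sum_t x_i^(t)] and [U_ij = \sum_(t in G i j) x_i^(t)], the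
    matrix is [1 - U + u 1^T]. Let [w_i] be the sum of the monomials of the paths
    that start at [i]; splitting off the first edge of a path gives [w = u + U w].
    Hence the matrix factors as [(1 - U) (1 + w 1^T)], where [1 - U] is
    unitriangular and [1 + w 1^T] has determinant [1 + \sum_i w_i]. *)

(** Both sides are the determinant of the block matrix with rows [1, w] and [- v, 1]: eliminating
    [w] leaves the Schur complement [1 + w *m v], eliminating [- v] leaves the scalar
    [1 + v *m w]. *)
Lemma det_add1_mulmx (R : comNzRingType) (n : nat) (w : 'cV[R]_n)
    (v : 'rV[R]_n) :
  \det (1%:M + w *m v) = 1 + (v *m w) 0 0.
Proof.
have detE : \det (block_mx 1%:M w (- v) 1%:M) = \det (1%:M + w *m v).
  have -> : block_mx 1%:M w (- v) 1%:M =
      block_mx 1%:M w 0 1%:M *m block_mx (1%:M + w *m v) 0 (- v) 1%:M.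
    rewrite mulmx_block !mul1mx !mulmx1 !mul0mx !add0r mulmxN.
    by rewrite addrK.
  by rewrite det_mulmx det_ublock det_lblock !det1 !mul1r mulr1.
rewrite -detE.
have -> : block_mx 1%:M w (- v) 1%:M =
    block_mx 1%:M 0 (- v) 1%:M *m block_mx 1%:M w 0 (1%:M + v *m w).
  rewrite mulmx_block !mul1mx !mulmx1 !mul0mx !addr0 mulNmx.
  by rewrite addrC addrK.
by rewrite det_mulmx det_ublock det_lblock !det1 !mul1r det_mx11 !mxE.
Qed.

Section FirstStep.

Variables (V C : finType) (G : colored_digraph V C) (acG : acyclic G).

Lemma colored_walk_is_path p : colored_walk G p.1 p.2 -> is_colored_path G p.
Proof. by rewrite acyclic_is_colored_path. Qed.

(** Removing the first edge maps the nontrivial paths from [i] bijectively to pairs of a color and a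
    path. Conversely, prepending an edge keeps the vertices distinct because [G] is acyclic. *)
Lemma sum_colored_path_first_step (M : nmodType) (F : seq (C * V) -> M) i :
  \sum_(P : colored_path G | (path_val P).1 == i) F (path_val P).2 =
    F [::] + \sum_j \sum_(r in G i j)
      \sum_(Q : colored_path G | (path_val Q).1 == j)
        F ((r, j) :: (path_val Q).2).
Proof.
pose p0 : colored_path G := ColoredPath (colored_walk_is_path (i, [::]) isT).
rewrite (bigD1 p0) ?eqxx //=; congr (_ + _).
(* When the color is not in [G i j], with [j] the start of the given path, the default [p0] is
   returned; the sum already excludes [p0], so such pairs drop out. *)
pose h (x : C * colored_path G) : colored_path G :=
  insubd p0 (i, (x.1, (path_val x.2).1) :: (path_val x.2).2).
pose h' (P : colored_path G) : option (C * colored_path G) :=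
  if (path_val P).2 is (r, j) :: s
  then omap (pair r) (insub (j, s)) else None.
have hE r (Q : colored_path G) : r \in G i (path_val Q).1 ->
    path_val (h (r, Q)) = (i, (r, (path_val Q).1) :: (path_val Q).2).
  move=> rQ; rewrite /h insubdK //; apply: colored_walk_is_path.
  by case: Q rQ => [[j s]] /= /andP[/= -> _] ->.
rewrite (reindex_omap h h') /=; last first.
  move=> [[i0 s] sP] /= /andP[/eqP ei ne0]; subst i0.
  case: s sP ne0 => [|[r j] s] sP ne0.
    by case/negP: ne0; apply/eqP/val_inj.
  have [/= /andP[rij sW] _] := andP sP.
  have jsP := colored_walk_is_path (j, s) sW.
  by rewrite /h' /= insubT /=; congr Some; apply/val_inj; rewrite /= hE.
transitivity (\sum_(x : C * colored_path G | x.1 \in G i (path_val x.2).1)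
    F ((x.1, (path_val x.2).1) :: (path_val x.2).2)).
  apply: eq_big => [[r Q]|[r Q]] /=.
    have [rQ|nrQ] := boolP (r \in _).
      have hP : h (r, Q) != p0.
        by apply/eqP => /(congr1 (fun P => size (path_val P).2)); rewrite hE.
      rewrite hP hE // eqxx /h' hE //= -surjective_pairing.
      by rewrite (valK Q) /= eqxx.
    apply/negP => /andP[/andP[_ ne0] _]; case/negP: ne0; apply/eqP/val_inj.
    rewrite /h val_insubd ifN //; apply: contra nrQ.
    by case/andP => /= /andP[].
  move=> /andP[/andP[_ ne0] _]; rewrite hE //; apply: contraNT ne0 => nrQ.
  apply/eqP/val_inj; rewrite /h val_insubd ifN //; apply: contra nrQ.
  by case/andP => /= /andP[].
(* Group the pairs by the second vertex [j] of the extended path. *)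
rewrite (partition_big (fun x : C * colored_path G => (path_val x.2).1) xpredT) //=.
apply: eq_bigr => j _; rewrite pair_big_dep /=.
apply: eq_big => [[r Q]|[r Q] /andP[_ /eqP <-]] //=.
by case: eqP => [->|]; rewrite ?andbF.
Qed.

End FirstStep.

Theorem theorem2p4 (R : comNzRingType) (n k : nat) (hn : (0 < n)%N)
    (hk : (0 < k)%N) (G : colored_digraph 'I_n 'I_k) (acG : acyclic G)
    (labG : forall i j : 'I_n, has_edge G i j -> (i < j)%N) :
  \det (digraph_mx R G) =
    1 + \sum_(P : colored_path G) \sum_(a < k)
          path_monomial R (path_val P).1 (path_val P).2 a.
Proof.
pose u : 'cV_n := \col_i \sum_(t < k) indet R i t.
pose U : 'M_n := \matrix_(i, j) \sum_(t in G i j) indet R i t.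
pose w : 'cV_n := \col_i \sum_(P : colored_path G | (path_val P).1 == i)
  \sum_(a < k) path_monomial R i (path_val P).2 a.
(* The labeling makes [U] strictly upper triangular. *)
have U0 (i j : 'I_n) : (j <= i)%N -> G i j = set0.
  by move=> ji; apply/eqP; apply: contraLR ji => /labG; rewrite -ltnNge.
have wE : w = u + U *m w.
  apply/colP => i; rewrite !mxE.
  rewrite (sum_colored_path_first_step _ _ _ acG _
    (fun s => \sum_(a < k) path_monomial R i s a)) /=.
  congr (_ + _); apply: eq_bigr => j _; rewrite !mxE mulr_suml.
  apply: eq_bigr => r _; rewrite mulr_sumr; apply: eq_bigr => Q _.
  by rewrite mulr_sumr.
have -> : digraph_mx R G = (1%:M - U) *m (1%:M + w *m const_mx 1).
  (* By [wE], [w - U *m w] is [u], so only [1 - U + u 1^T] has to be compared entrywise. *)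
  rewrite mulmxDr mulmx1 mulmxA mulmxBl mul1mx {1}wE addrK.
  apply/matrixP => i j; rewrite !mxE big_ord1 !mxE mulr1.
  have [->|nij] := eqVneq i j.
    by rewrite U0 // big_set0 subr0.
  rewrite add0r; case: ltnP => [_|ji]; last by rewrite U0 // big_set0 oppr0 add0r.
  by rewrite [X in _ + X](bigID (mem (G i j))) /= addKr.
(* [det_trig] expects a lower triangular matrix, hence the transpose of [1 - U]. *)
rewrite det_mulmx det_add1_mulmx -det_tr det_trig; last first.
  apply/is_trig_mxP => i j ij; rewrite !mxE U0 ?(ltnW ij) // big_set0 subr0.
  by rewrite -val_eqE gtn_eqF.
rewrite big1 ?mul1r => [|i _]; last by rewrite !mxE eqxx U0 // big_set0 subr0.
congr (_ + _); rewrite mxE.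
(* Sorting the paths by their first vertex turns the sum over all paths into the sum of the entries
   of [w]. *)
rewrite [RHS](partition_big (fun P : colored_path G => (path_val P).1) xpredT) //=.
apply: eq_bigr => i _; rewrite !mxE mul1r.
by apply: eq_bigr => P /eqP ->.
Qed.
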